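(* Let $\alpha\ge\aleph_0$ be a cardinal number, $I=[0,\gamma)$ with $0<\gamma\le\infty$, and let $w$ be a weight function on $I$. Let $\varphi$ and $\varphi_n$ ($n\ge1$) be Orlicz functions such that each $\varphi_n$ satisfies the $\Delta_\varphi(\infty)$-condition and such that, for every $n\in\mathbb{N}$, $\varphi_{n+1}\prec\varphi_n$ if $\gamma=\infty$ (respectively, $\varphi_{n+1}\prec_\infty\varphi_n$ if $\gamma<\infty$). Then: (i) If $\aleph_0\le\alpha\le\mathfrak{c}$ or $\alpha>\mathrm{card}((\Lambda_{\varphi,w})_a)$, then $(\Lambda_{\varphi,w})_a\setminus\bigcup_{n=1}^\infty\Lambda_{\varphi_n,w}$ is not $(\alpha,\beta)$-spaceable in $(\Lambda_{\varphi,w})_a$, for any cardinal number $\beta\ge\alpha$. (ii) If $\varphi$ satisfies the $\Delta_2$-condition when $\gamma=\infty$ (respectively, the $\Delta_2^\infty$-condition when $\gamma<\infty$), then $\Lambda_{\varphi,w}\setminus\bigcup_{n=1}^\infty\Lambda_{\varphi_n,w}$ is not $(\alpha,\beta)$-spaceable in $\Lambda_{\varphi,w}$, for any cardinal number $\beta\ge\alpha$.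
   Context: The interval $I=[0,\gamma)$ carries Lebesgue measure $m$. $L_0$ is the space of real Lebesgue measurable functions on $I$ modulo a.e. equality. For $f\in L_0$, $d_f(\lambda)=m(\{t\in I:|f(t)|>\lambda\})$ for $\lambda>0$, and $f^*(t)=\inf\{\lambda>0:d_f(\lambda)\le t\}$ for $t\ge 0$ (with $\inf\varnothing=\infty$). An Orlicz function is a convex function $\varphi:[0,\infty)\to[0,\infty)$ with $\varphi(0)=0=\lim_{u\to0}\varphi(u)$ and $\varphi(u)>0$ for $u>0$ (put $\varphi(\infty)=\infty$). It satisfies the $\Delta_2^\infty$-condition if there are $K>2$, $u_0\ge0$ with $\varphi(2u)\le K\varphi(u)$ for all $u\ge u_0$; the $\Delta_2^0$-condition if there are $K>2$, $u_0>0$ with $\varphi(2u)\le K\varphi(u)$ for all $0\le u\le u_0$; the $\Delta_2$-condition if it satisfies both. An Orlicz function $\psi$ satisfies the $\Delta_\varphi(\infty)$-condition if for every $b>0$ there exists $u_0$ such that $\varphi(u)\le\psi(bu)$ for every $u\ge u_0$. Write $\varphi\prec\psi$ if there is $b>0$ with $\varphi(u)\le\psi(bu)$ for all $u\ge0$, and $\varphi\prec_\infty\psi$ if there are $b>0$, $u_0\ge0$ with $\varphi(u)\le\psi(bu)$ for all $u\ge u_0$. A weight function on $I$ is a positive, decreasing (i.e. nonincreasing) function $w:I\setminus\{0\}\to(0,\infty)$ with $\int_0^t w<\infty$ for every $t\in I$; if $\gamma=\infty$ it is also assumed that $\int_0^\infty w=\infty$. The modular is $\rho_{\varphi,w}(f)=\int_I\varphi(f^*(t))w(t)\,dt$.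 The Orlicz-Lorentz space is $\Lambda_{\varphi,w}=\{f\in L_0:\rho_{\varphi,w}(kf)<\infty\text{ for some }k>0\}$ with the Luxemburg norm $\|f\|_{\varphi,w}=\inf\{\varepsilon>0:\rho_{\varphi,w}(f/\varepsilon)\le1\}$ (a Banach space). $(\Lambda_{\varphi,w})_a$ is its closed subspace of order-continuous elements (those $f$ with $\|f_n\|_{\varphi,w}\downarrow0$ whenever $|f_n|\le|f|$ and $|f_n|\downarrow0$ a.e.); it is well known that $(\Lambda_{\varphi,w})_a=\{f\in L_0:\rho_{\varphi,w}(kf)<\infty\text{ for every }k>0\}$. $\mathfrak{c}$ is the cardinality of the continuum. For a subset $A$ of a topological vector space $X$ and cardinals $\alpha\le\beta$: $A$ is $\alpha$-lineable if there is an $\alpha$-dimensional vector subspace $M\subset X$ with $M\subset A\cup\{0\}$; $A$ is $(\alpha,\beta)$-spaceable if $A$ is $\alpha$-lineable and for every $\alpha$-dimensional vector subspace $M_\alpha$ of $X$ with $M_\alpha\subset A\cup\{0\}$ there is a closed $\beta$-dimensional vector subspace $M_\beta$ of $X$ with $M_\alpha\subset M_\beta\subset A\cup\{0\}$. *)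

(* Defs.v *)
From HB Require Import structures.
From mathcomp Require Import all_boot all_order all_algebra.
From mathcomp Require Import all_classical all_reals ereal topology normedtype.
From mathcomp Require Import sequences convex measure measurable_realfun.
From mathcomp Require Import lebesgue_measure lebesgue_integral hoelder.

Set Implicit Arguments.
Unset Strict Implicit.
Unset Printing Implicit Defensive.
Import Order.TTheory GRing.Theory Num.Theory.
Import numFieldNormedType.Exports.

Local Open Scope classical_set_scope.
Local Open Scope ring_scope.
Local Open Scope card_scope.

(* The library quotient {mfun_ mu, T >-> R} of the measurable functions by
   mu-a.e. equality comes without its vector space structure. *)
Section aeEqMfun_lmodType.
Context d (T : measurableType d) (R : realType).
Variable mu : {measure set T -> \bar R}.
Local Open Scope quotient_scope.
Local Notation L0 := {mfun_ mu, T >-> R}.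
Implicit Types (f g h : {mfun T >-> R}) (u v : L0) (a b : R).

Lemma pi_aeEqMfunP f g : \pi_L0 f = \pi_L0 g <-> f = g %[ae mu].
Proof.
split; first by move=> /eqP; rewrite eqmodE => /asboolP.
by move=> fg; apply/eqP; rewrite eqmodE; apply/asboolP.
Qed.

Lemma repr_aeEqMfun f : repr (\pi_L0 f) = f %[ae mu].
Proof. by apply/pi_aeEqMfunP; rewrite reprK. Qed.

Definition aeEqMfun_zero : L0 := \pi_L0 (0 : {mfun T >-> R}).
Definition aeEqMfun_add u v : L0 := \pi_L0 (repr u + repr v : {mfun T >-> R}).
Definition aeEqMfun_opp u : L0 := \pi_L0 (- repr u : {mfun T >-> R}).
Definition aeEqMfun_scale a u : L0 := \pi_L0 (a *: repr u : {mfun T >-> R}).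

Lemma pi_aeEqMfun_add f g :
  aeEqMfun_add (\pi_L0 f) (\pi_L0 g) = \pi_L0 (f + g : {mfun T >-> R}).
Proof.
apply/pi_aeEqMfunP; move: (repr_aeEqMfun f) (repr_aeEqMfun g).
by apply: filterS2 => t /(_ I) ef /(_ I) eg _; exact: (f_equal2 +%R ef eg).
Qed.

Lemma pi_aeEqMfun_opp f : aeEqMfun_opp (\pi_L0 f) = \pi_L0 (- f : {mfun T >-> R}).
Proof.
apply/pi_aeEqMfunP; move: (repr_aeEqMfun f).
by apply: filterS => t /(_ I) ef _; exact: (congr1 -%R ef).
Qed.

Lemma pi_aeEqMfun_scale a f :
  aeEqMfun_scale a (\pi_L0 f) = \pi_L0 (a *: f : {mfun T >-> R}).
Proof.
apply/pi_aeEqMfunP; move: (repr_aeEqMfun f).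
by apply: filterS => t /(_ I) ef _; exact: (congr1 ( *%R a) ef).
Qed.

Let addA : associative aeEqMfun_add.
Proof.
elim/quotW => f; elim/quotW => g; elim/quotW => h.
by rewrite (pi_aeEqMfun_add g h) (pi_aeEqMfun_add f g) !pi_aeEqMfun_add addrA.
Qed.

Let addC : commutative aeEqMfun_add.
Proof.
by elim/quotW => f; elim/quotW => g; rewrite !pi_aeEqMfun_add addrC.
Qed.

Let add0 : left_id aeEqMfun_zero aeEqMfun_add.
Proof. by elim/quotW => f; rewrite pi_aeEqMfun_add add0r. Qed.

Let addN : left_inverse aeEqMfun_zero aeEqMfun_opp aeEqMfun_add.
Proof.
by elim/quotW => f; rewrite (pi_aeEqMfun_opp f) pi_aeEqMfun_add addNr.
Qed.

HB.instance Definition _ := GRing.isZmodule.Build L0 addA addC add0 addN.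

Let scaleA a b u :
  aeEqMfun_scale a (aeEqMfun_scale b u) = aeEqMfun_scale (a * b) u.
Proof. by elim/quotW: u => f; rewrite (pi_aeEqMfun_scale b f) !pi_aeEqMfun_scale scalerA. Qed.

Let scale1 : left_id 1 aeEqMfun_scale.
Proof. by elim/quotW => f; rewrite pi_aeEqMfun_scale scale1r. Qed.

Let scaleDr : right_distributive aeEqMfun_scale +%R.
Proof.
move=> a; elim/quotW => f; elim/quotW => g.
transitivity (aeEqMfun_scale a (\pi_L0 (f + g : {mfun T >-> R}))).
  exact: (congr1 _ (pi_aeEqMfun_add f g)).
by rewrite pi_aeEqMfun_scale scalerDr -pi_aeEqMfun_add -!pi_aeEqMfun_scale.
Qed.

Let scaleDl u : {morph aeEqMfun_scale^~ u : a b / a + b}.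
Proof.
move=> a b; elim/quotW: u => f.
by rewrite pi_aeEqMfun_scale scalerDl -pi_aeEqMfun_add -!pi_aeEqMfun_scale.
Qed.

HB.instance Definition _ := GRing.Zmodule_isLmodule.Build R L0
  scaleA scale1 scaleDr scaleDl.

End aeEqMfun_lmodType.

(* Cardinal numbers are represented by types up to bijection: the cardinal of
   alpha is that of [set: alpha]. *)
Section spaceability.
Context (R : realType) (V : lmodType R).
Implicit Types (M B X A : set V) (N : V -> \bar R) (alpha beta : Type).

Definition vect_subspace M :=
  [/\ M 0, forall u v, M u -> M v -> M (u + v) &
      forall (a : R) u, M u -> M (a *: u)].

Definition lin_indep B := forall (s : seq V) (c : V -> R),
  uniq s -> [set` s] `<=` B -> \sum_(v <- s) c v *: v = 0 ->
  forall v, v \in s -> c v = 0.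

Definition lin_span B : set V :=
  [set u | exists (s : seq V) (c : V -> R),
    [set` s] `<=` B /\ u = \sum_(v <- s) c v *: v].

(* M has a Hamel basis of cardinality alpha *)
Definition dim_subspace alpha M :=
  vect_subspace M /\
  exists B, [/\ lin_indep B, lin_span B = M & B #= [set: alpha]].

(* M is closed in X for the topology of the norm N on X *)
Definition norm_closed N X M := forall u, X u ->
  (forall e : R, 0 < e -> exists2 v, M v & (N (u - v)%R < e%:E)%E) -> M u.

Definition lineable X A alpha := exists M,
  [/\ dim_subspace alpha M, M `<=` X & M `<=` A `|` [set 0]].

Definition spaceable N X A alpha beta :=
  lineable X A alpha /\
  forall Ma, dim_subspace alpha Ma -> Ma `<=` X -> Ma `<=` A `|` [set 0] ->
  exists Mb, [/\ dim_subspace beta Mb, Mb `<=` X, norm_closed N X Mb,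
                 Ma `<=` Mb & Mb `<=` A `|` [set 0]].

End spaceability.

Definition card_lt (T U : Type) (A : set T) (B : set U) :=
  (A #<= B) && ~~ (B #<= A).

Section orlicz_functions.
Context (R : realType).
Implicit Types phi psi : R -> R.

(* Functions on [0, oo) are represented by total functions on R, of which only
   the values on [0, oo) matter. *)
Definition orlicz phi :=
  [/\ convex_function (`[0, +oo[%classic : set R) phi,
      phi 0 = 0,
      phi u @[u --> 0^'+] --> 0 &
      forall u, 0 < u -> 0 < phi u].

Definition Delta2_oo phi := exists K u0 : R,
  [/\ 2 < K, 0 <= u0 & forall u, u0 <= u -> phi (2 * u) <= K * phi u].

Definition Delta2_0 phi := exists K u0 : R,
  [/\ 2 < K, 0 < u0 & forall u, 0 <= u <= u0 -> phi (2 * u) <= K * phi u].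

Definition Delta2 phi := Delta2_oo phi /\ Delta2_0 phi.

(* psi satisfies the condition Delta_phi(oo) *)
Definition Delta_oo phi psi := forall b : R, 0 < b ->
  exists2 u0 : R, 0 <= u0 & forall u, u0 <= u -> phi u <= psi (b * u).

Definition prec phi psi := exists2 b : R, 0 < b &
  forall u, 0 <= u -> phi u <= psi (b * u).

Definition prec_oo phi psi := exists b u0 : R,
  [/\ 0 < b, 0 <= u0 & forall u, u0 <= u -> phi u <= psi (b * u)].

End orlicz_functions.

(* R with the sigma-algebra of Lebesgue measurable sets *)
Definition lebesgueTypeR (R : realType) :=
  caratheodory_type ((@wlength R idfun)^*)%mu.
HB.instance Definition _ (R : realType) := Measurable.on (lebesgueTypeR R).

Section orlicz_lorentz.
Context (R : realType) (gamma : \bar R).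
Local Open Scope ereal_scope.

Definition itvI : set (lebesgueTypeR R) :=
  [set t : R | (0 <= t)%R /\ t%:E < gamma].

Lemma measurable_itvI : measurable itvI.
Proof.
apply: sub_caratheodory.
rewrite (_ : itvI = [set` Interval (BLeft 0%R)
  (match gamma with r%:E => BLeft r | +oo => BInfty _ false
   | -oo => BInfty _ true end)]); first exact: (measurable_itv (R := R)).
apply/seteqP; rewrite /itvI; split => t /=; rewrite in_itv/=;
  case: gamma => [r| |] //=; rewrite ?lte_fin ?ltry ?andbT ?andbF//.
- by move=> [-> ->].
- by move=> [].
- by move=> [].
- by move=> /andP[].
Qed.

Definition leb : set (lebesgueTypeR R) -> \bar R := completed_lebesgue_measure.
HB.instance Definition _ := Measure.on leb.

Definition lebI := mrestr leb measurable_itvI.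
HB.instance Definition _ := Measure.on lebI.

(* Functions on I are represented by functions on R up to a.e. equality on I. *)
Local Notation L0 := {mfun_ lebI, lebesgueTypeR R >-> R}.

Implicit Types (f g : L0) (phi w : R -> R).

Definition distribution_fun f (l : R) : \bar R :=
  leb [set t | itvI t /\ (l < `|f t|)%R].

Definition rearrangement f (t : R) : \bar R :=
  ereal_inf [set l%:E | l in [set l : R | (0 < l)%R /\
                                          distribution_fun f l <= t%:E]].

Definition weight w :=
  [/\ forall t : R, (0 < t)%R -> t%:E < gamma -> (0 < w t)%R,
      forall s t : R, (0 < s)%R -> (s <= t)%R -> t%:E < gamma -> (w t <= w s)%R,
      forall t : R, itvI t ->
        \int[lebesgue_measure]_(s in `]0%R, t[) (w s)%:E < +oo &
      gamma = +oo ->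
        \int[lebesgue_measure]_(s in `]0%R, +oo[) (w s)%:E = +oo].

(* er_map extends phi by phi(oo) = oo; the integrand is nonincreasing, hence
   Borel, and w is defined on I \ {0} *)
Definition modular phi w f : \bar R :=
  \int[lebesgue_measure]_(t in [set t : R | (0 < t)%R /\ t%:E < gamma])
    (er_map phi (rearrangement f t) * (w t)%:E).

Definition Lambda phi w : set L0 :=
  [set f | exists2 k : R, (0 < k)%R & modular phi w (k *: f) < +oo].

Definition luxemburg phi w f : \bar R :=
  ereal_inf [set e%:E | e in [set e : R | (0 < e)%R /\
                                          modular phi w (e^-1 *: f) <= 1]].

(* the order-continuous elements of Lambda phi w *)
Definition Lambda_a phi w : set L0 :=
  [set f | Lambda phi w f /\
    forall f_ : nat -> L0,
      (forall n, \forall t \ae lebI, (`|f_ n t| <= `|f t|)%R) ->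
      (\forall t \ae lebI, nonincreasing_seq (fun n => `|f_ n t|%R) /\
                           (fun n => `|f_ n t|%R) @ \oo --> (0 : R)%R) ->
      nonincreasing_seq (fun n => luxemburg phi w (f_ n)) /\
      (fun n => luxemburg phi w (f_ n)) @ \oo --> (0 : \bar R)].

End orlicz_lorentz.

(* Main.v *)
Require Import Defs.
From HB Require Import structures.
From mathcomp Require Import all_boot all_order all_algebra.
From mathcomp Require Import all_classical all_reals ereal topology normedtype.
From mathcomp Require Import sequences convex measure measurable_realfun.
From mathcomp Require Import lebesgue_measure lebesgue_integral hoelder.
From mathcomp Require Import ring lra charge.
Set Implicit Arguments.
Unset Strict Implicit.
Unset Printing Implicit Defensive.
Import Order.TTheory GRing.Theory Num.Theory.
Import numFieldNormedType.Exports.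
Local Open Scope classical_set_scope.
Local Open Scope ring_scope.
Local Open Scope card_scope.

(** The statement is purely linear once two facts are known about the function
    spaces. Let X be [Lambda_a phi w] or [Lambda phi w], let U_n be
    [Lambda (phi_ n) w], and let A be X minus the union of the U_n.

    The facts are that X and all the U_n are vector subspaces, and that the
    indicator g of a short interval [[0, a[] is a nonzero element of X and of
    every U_n. Suppose now that A is lineable: some M with Hamel basis B of
    cardinality alpha lies in A with zero. For positive scalars r_v the vectors
    g - r_v v, with v in B, are again independent and again span a subspace
    inside A with zero, because modulo g, hence modulo each U_n, their
    combinations are combinations of B with rescaled coefficients. As B is
    infinite and elements of X have small multiples of small norm, the r_v can
    be chosen so that r_v v tends to zero along a sequence in B. The span of
    the perturbed basis thus has g in its closure; any closed subspace of X
    above it contains g, and so is not contained in A with zero. Hence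
    lineability by itself contradicts spaceability for every infinite alpha, and
    both parts follow from [complement_not_spaceable].

    On the analytic side, [modular_sub] bounds the modular of a half-sum by
    twice the sum of the modulars. It makes the spaces stable by addition,
    directly for [Lambda] and, for the order-continuous elements, after a Riesz
    decomposition of the dominated sequence ([Lambda_a_subspace]). That g is
    order-continuous ([Lambda_a_indic_itv]) comes from the explicit bound
    [modular_le_bounded] for bounded functions of bounded support. *)

(** * Linear spans *)

Section linear_spans.
Context (R : realType) (V : lmodType R).
Implicit Types (s S : seq V) (M B : set V) (c : V -> R) (u v : V).

Lemma big_uniq_count s S (F : V -> V) : uniq S -> {subset s <= S} ->
  \sum_(v <- s) F v = \sum_(v <- S) F v *+ count_mem v s.
Proof.
move=> uS; elim: s => [_|x s IH sS]; first by rewrite big_nil big1.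
rewrite big_cons IH; last by move=> v vs; apply: sS; rewrite in_cons vs orbT.
under [RHS]eq_bigr do rewrite /= mulrnDr.
rewrite big_split /=; congr (_ + _).
rewrite (bigD1_seq x) ?sS ?mem_head //= eqxx mulr1n big1 ?addr0 // => v vx.
by rewrite eq_sym (negbTE vx).
Qed.

(** The families in [lin_span] may repeat vectors; collecting repetitions and
    padding to a larger duplicate-free support makes two combinations
    comparable coefficient by coefficient. *)
Lemma sum_scale_support s S c : uniq S -> {subset s <= S} ->
  \sum_(v <- s) c v *: v = \sum_(v <- S) ((count_mem v s)%:R * c v) *: v.
Proof.
move=> uS sS; rewrite (big_uniq_count _ uS sS); apply: eq_bigr => v _.
by rewrite -scalerA scaler_nat.
Qed.

Lemma lin_span_uniq B u : lin_span B u -> exists s c,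
  [/\ uniq s, [set` s] `<=` B & u = \sum_(v <- s) c v *: v].
Proof.
move=> [s [c [sB ->]]]; exists (undup s), (fun v => (count_mem v s)%:R * c v).
split; first exact: undup_uniq.
  by move=> v; rewrite /= mem_undup => /sB.
apply: sum_scale_support; first exact: undup_uniq.
by move=> v; rewrite mem_undup.
Qed.

Lemma lin_span_subspace B : vect_subspace (lin_span B).
Proof.
split.
- by exists [::], (fun=> 0); split => //; rewrite big_nil.
- move=> u v [s [c [sB ->]]] [s' [c' [sB' ->]]].
  exists (undup (s ++ s')),
    (fun x => (count_mem x s)%:R * c x + (count_mem x s')%:R * c' x).
  split.
    by move=> x; rewrite /= mem_undup mem_cat => /orP[/sB|/sB'].
  under [RHS]eq_bigr do rewrite scalerDl.
  rewrite big_split /=; congr (_ + _); apply: sum_scale_support;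
    rewrite ?undup_uniq // => x; rewrite mem_undup mem_cat => -> //.
  by rewrite orbT.
- move=> a u [s [c [sB ->]]]; exists s, (fun x => a * c x); split => //.
  by rewrite scaler_sumr; apply: eq_bigr => x _; rewrite scalerA.
Qed.

Lemma subset_lin_span B : B `<=` lin_span B.
Proof.
move=> v Bv; exists [:: v], (fun=> 1); split.
  by move=> x /=; rewrite mem_seq1 => /eqP ->.
by rewrite big_seq1 scale1r.
Qed.

Lemma vect_subspace_sum M (I : eqType) (s : seq I) (F : I -> V) :
  vect_subspace M -> (forall i, i \in s -> M (F i)) -> M (\sum_(i <- s) F i).
Proof.
move=> [M0 MD _] MF; rewrite big_seq.
by elim/big_ind: _ => //; exact: MD.
Qed.

Lemma lin_span_sub M B : vect_subspace M -> B `<=` M -> lin_span B `<=` M.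
Proof.
move=> sM BM _ [s [c [sB ->]]]; apply: vect_subspace_sum => // v vs.
by have [_ _] := sM; apply; exact/BM/sB.
Qed.

End linear_spans.

(** * Complements of unions of subspaces *)

Section spaceability_of_complements.
Context (R : realType) (V : lmodType R).
Variables (N : V -> \bar R) (X : set V) (U_ : nat -> set V) (g : V).
Hypotheses (sX : vect_subspace X) (sU : forall n, vect_subspace (U_ n)).
Hypotheses (Xg : X g) (Ug : forall n, U_ n g) (g0 : g != 0).
Local Notation A := (X `\` \bigcup_n U_ n).

(** A basis of a subspace inside [A] with zero is moved by [v |-> g - r v *: v].
    A combination of the moved vectors differs from a combination of the
    original ones, with rescaled coefficients, by a multiple of [g], which lies
    in every [U_ n]; so it can lie in some [U_ n] only if all its coefficients
    vanish. This one fact gives both the independence of the moved basis and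
    the inclusion of its span in [A] with zero. *)
Section perturbation.
Variables (B : set V) (r : V -> R).
Hypotheses (Bindep : lin_indep B) (BA : lin_span B `<=` A `|` [set 0]).
Hypothesis (r0 : forall v, 0 < r v).
Let T v := g - r v *: v.

Lemma perturb_injective : {in B &, injective T}.
Proof.
move=> v w /set_mem Bv /set_mem Bw /addrI/oppr_inj e; apply: contrapT => vw.
have wv : w <> v by move=> wv; apply: vw.
(* T v = T w turns r v *: v - r w *: w into a dependence relation. *)
pose c x := if x == v then r v else - r w.
suff : c v = 0 by rewrite /c eqxx => rv0; have := r0 v; rewrite rv0 ltxx.
apply: (Bindep (s := [:: v; w])).
- by rewrite /= mem_seq1 eq_sym andbT; apply/eqP.
- by move=> x /=; rewrite !inE => /orP[]/eqP ->.
- rewrite big_cons big_seq1 /c eqxx.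
  by rewrite (introF eqP wv) e scaleNr subrr.
- exact: mem_head.
Qed.

Lemma perturb_coef (s : seq V) (c : V -> R) :
  uniq s -> [set` s] `<=` B ->
  (\bigcup_n U_ n) (\sum_(v <- s) c v *: T v) -> forall v, v \in s -> c v = 0.
Proof.
move=> us sB [n _ Uu].
pose m := \sum_(v <- s) (c v * r v) *: v.
have Eu : \sum_(v <- s) c v *: T v = (\sum_(v <- s) c v) *: g - m.
  rewrite scaler_suml /m -sumrB; apply: eq_bigr => v _.
  by rewrite scalerBr scalerA.
(* m is what the combination leaves modulo g, and g is in U_ n. *)
have Um : U_ n m.
  have -> : m = (\sum_(v <- s) c v) *: g + (-1) *: (\sum_(v <- s) c v *: T v).
    by rewrite Eu scaleN1r opprB addrCA subrr addr0.
  have [_ UD UZ] := sU n.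
  by apply: UD; [exact: UZ|exact: UZ].
have m0 : m = 0.
  have : lin_span B m by exists s, (fun v => c v * r v).
  by move=> /BA[[_ []]|//]; exists n.
move=> v vs; have /eqP := Bindep us sB m0 vs.
by rewrite mulf_eq0 (gt_eqF (r0 v)) orbF => /eqP.
Qed.

Lemma perturb_lift (s : seq V) : uniq s -> [set` s] `<=` T @` B ->
  exists t, [/\ uniq t, [set` t] `<=` B & s = map T t].
Proof.
elim: s => [_ _|x s IH]; first by exists [::].
move=> /= /andP[xs us] sTB.
have [|t [ut tB st]] := IH us.
  by move=> y ys; apply: sTB; rewrite /= in_cons ys orbT.
have [|v Bv Tv] := sTB x; first exact: mem_head.
exists (v :: t); split => /=; last by rewrite -st Tv.
  rewrite ut andbT; apply: contra xs => vt.
  by rewrite st -Tv; exact: map_f.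
by move=> y /=; rewrite in_cons => /orP[/eqP ->//|/tB].
Qed.

Lemma perturb_indep : lin_indep (T @` B).
Proof.
move=> s c us sTB; have [t [ut tB ->]] := perturb_lift us sTB.
rewrite big_map => e _ /mapP[v vt ->].
apply: (perturb_coef (c := c \o T) ut tB _ vt) => /=.
by rewrite e; exists 0%N => //; have [] := sU 0.
Qed.

Lemma perturb_subset : lin_span (T @` B) `<=` A `|` [set 0].
Proof.
have BX : lin_span B `<=` X by move=> x /BA[[]|->] //; have [] := sX.
move=> u Su; have [Uu|nUu] := pselect ((\bigcup_n U_ n) u); last first.
  left; split => //; move: Su; apply: lin_span_sub => // _ [v Bv <-].
  have [_ XD XZ] := sX; apply: XD => //.
  rewrite -scaleNr; apply: XZ; exact/BX/subset_lin_span.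
right => /=; have [s [c [us sTB eu]]] := lin_span_uniq Su.
have [t [ut tB st]] := perturb_lift us sTB.
move: eu Uu; rewrite st big_map => -> Uu.
rewrite big_seq big1 // => v vt.
have := perturb_coef (c := c \o T) ut tB Uu vt.
by rewrite /= => ->; rewrite scale0r.
Qed.

End perturbation.

(** Lineability itself provides the obstruction: the moved basis spans an
    admissible subspace of the same dimension, and along a sequence [e] of
    basis vectors the scales [r (e n)] make [g - r (e n) *: e n] converge to
    [g]. Every closed subspace above that span contains [g], which is a nonzero
    element outside [A]. *)
Theorem complement_not_spaceable (alpha beta : Type) :
  [set: nat] #<= [set: alpha] ->
  (forall u (e : R), X u -> 0 < e -> exists2 r : R, 0 < r & (N (r *: u) < e%:E)%E) ->
  ~ spaceable N X A alpha beta.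
Proof.
move=> alpha_oo Nsmall [[M [[sM [B [Bi BM Ba]]] MX MA]] H].
have BX : B `<=` X by move=> v Bv; apply: MX; rewrite -BM; exact: subset_lin_span.
have /card_leP/unsquash f : [set: nat] #<= B by rewrite (card_le_eqr Ba).
pose e n : V := set_val (f (to_setT n)).
have eB n : B (e n) by exact/set_mem/valP.
have einj : injective e.
  move=> m n /val_inj fmn; have : to_setT m = to_setT n.
    by apply: (@inj _ _ _ f) fmn; rewrite inE.
  by move=> /(congr1 set_val).
(* lab inverts e, so that one function r serves the whole basis. *)
pose lab v : nat := xget 0%N [set n | e n = v].
have labe n : lab (e n) = n.
  by apply: einj; apply: (@xgetPex _ 0%N [set k | e k = e n]); exists n.
have /choice[r rP] : forall v, exists r : R, 0 < r /\
    (X v -> (N (r *: v) < ((lab v).+1%:R^-1)%:E)%E).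
  move=> v; have [Xv|nXv] := pselect (X v); last by exists 1.
  by have [|r r0 Nr] := Nsmall v ((lab v).+1%:R^-1) Xv; [rewrite invr_gt0|exists r].
have r0 v : 0 < r v by have [] := rP v.
have BA : lin_span B `<=` A `|` [set 0] by rewrite BM.
have Ma_A := perturb_subset Bi BA r0.
pose Ma := lin_span ((fun v => g - r v *: v) @` B).
have [|||Mb [_ _ clMb MaMb MbA]] := H Ma.
- split; first exact: lin_span_subspace.
  exists ((fun v => g - r v *: v) @` B); split => //.
    exact: perturb_indep.
  rewrite -(card_eqr Ba); apply: inj_card_eq; exact: perturb_injective.
- by move=> x /Ma_A[[]|->] //; have [] := sX.
- exact: Ma_A.
have : Mb g.
  apply: clMb => // eps eps0.
  have [n ne] : exists n, n.+1%:R^-1 < eps.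
    by have [n] := ltr_add_invr eps0; rewrite add0r; exists n.
  exists (g - r (e n) *: e n).
    by apply: MaMb; apply: subset_lin_span; exists (e n).
  rewrite opprB addrCA subrr addr0.
  have [_ /(_ (BX _ (eB n)))] := rP (e n); rewrite labe => /lt_trans; apply.
  by rewrite lte_fin.
move=> /MbA[[_]|/= /eqP]; last by rewrite (negbTE g0).
by apply; exists 0%N.
Qed.

End spaceability_of_complements.

(** * Orlicz functions *)

Section orlicz_theory.
Context (R : realType) (psi : R -> R) (psiP : orlicz psi).

Lemma orlicz_ge0 u : 0 <= u -> 0 <= psi u.
Proof.
have [_ p0 _ pp] := psiP.
by rewrite le_eqVlt => /orP[/eqP <-|/pp/ltW //]; rewrite p0.
Qed.

Lemma orlicz_contract s u : 0 <= s <= 1 -> 0 <= u -> psi (s * u) <= s * psi u.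
Proof.
have [cp p0 _ _] := psiP; move=> /andP[s0 s1] u0.
have := cp (Itv01 s0 s1) u 0.
rewrite !inE/= !in_itv/= u0 lexx => /(_ isT isT).
by rewrite convRE /conv/= p0 scaler0 mulr0 !addr0.
Qed.

Lemma orlicz_le u v : 0 <= u -> u <= v -> psi u <= psi v.
Proof.
move=> u0 uv; have v0 := le_trans u0 uv.
have [vE|vN0] := eqVneq v 0.
  by have -> : u = v by apply/eqP; rewrite eq_le uv vE.
have vp : 0 < v by rewrite lt_def vN0.
have s01 : 0 <= u / v <= 1 by rewrite divr_ge0//= ler_pdivrMr// mul1r.
rewrite -{1}(divfK vN0 u); apply: (le_trans (orlicz_contract s01 v0)).
by rewrite ler_piMl ?orlicz_ge0//; case/andP: s01.
Qed.

Local Open Scope ereal_scope.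

Lemma er_orlicz_ge0 x : 0 <= x -> 0 <= er_map psi x.
Proof. by case: x => [r| |]//=; rewrite !lee_fin; exact: orlicz_ge0. Qed.

Lemma er_orlicz_le x y : 0 <= x -> x <= y -> er_map psi x <= er_map psi y.
Proof.
by case: x => [x| |]//; case: y => [y| |]//=; rewrite ?leey ?lee_fin//;
  exact: orlicz_le.
Qed.

Lemma er_orlicz_contract (s : R) x : (0 < s <= 1)%R -> 0 <= x ->
  er_map psi (s%:E * x) <= s%:E * er_map psi x.
Proof.
move=> /andP[s0 s1]; case: x => [x| |]//=.
  by rewrite !lee_fin => x0; apply: orlicz_contract; rewrite ?(ltW s0).
by rewrite gt0_muley ?lte_fin//= gt0_muley ?lte_fin// leey.
Qed.

(** The larger of the two arguments, doubled, dominates their sum. *)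
Lemma er_orliczD x y : 0 <= x -> 0 <= y ->
  er_map psi (x + y) <= er_map psi (2%:E * x) + er_map psi (2%:E * y).
Proof.
have le2 (z : \bar R) : 0 <= z -> z <= 2%:E * z.
  by case: z => [z| |]//=; [rewrite !lee_fin; lra|rewrite gt0_muley// lte_fin].
wlog xy : x y / x <= y.
  by move=> H x0 y0; have [xy|/ltW yx] := leP x y; [|rewrite addeC [leRHS]addeC];
    exact: H.
move=> x0 y0; apply: (@le_trans _ _ (er_map psi (2%:E * y))).
  apply: er_orlicz_le; first exact: adde_ge0.
  have -> : 2%:E * y = y + y.
    by rewrite -[2%R]/(1 + 1)%R EFinD ge0_muleDl ?mul1e// lee_fin.
  exact: leeD2r.
by rewrite leeDr// er_orlicz_ge0// mule_ge0.
Qed.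

End orlicz_theory.

(** * Monotone functions and dilations on the real line *)

Section real_line_integrals.
Context (R : realType).
Local Open Scope ereal_scope.
Local Notation mu := (@lebesgue_measure R).

Lemma nonincreasing_in_measurable (D : set R) (F : R -> \bar R) :
  is_interval D -> (forall s t, D s -> D t -> (s <= t)%R -> F t <= F s) ->
  measurable_fun D F.
Proof.
move=> iD niF; have mD : measurable D by exact: is_interval_measurable.
apply: (measurability (@ErealGenCInfty.G R)) => [|/= _ [_] [r] -> <-].
  exact: ErealGenCInfty.measurableE.
apply: is_interval_measurable => s t [Ds Fs] [Dt Ft] u /andP[su ut].
have Du : D u by apply: (iD s t) => //; rewrite su ut.
split => //; move: Ft; rewrite /= !in_itv/= !andbT => /le_trans; apply.
exact: niF.
Qed.

Definition half (t : measurableTypeR R) : measurableTypeR R := (2^-1 * t)%R.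

Lemma measurable_half : measurable_fun setT half.
Proof. exact: measurable_funM. Qed.

HB.instance Definition _ := isMeasurableFun.Build _ _ _ _ half measurable_half.

Lemma half_preimage_ocitv (a b : R) :
  half @^-1` `]a, b] = `](2 * a)%R, (2 * b)%R]%classic.
Proof.
apply/seteqP; split => t /=; rewrite !in_itv/= /half => /andP[at_ tb].
  by apply/andP; split; lra.
by apply/andP; split; lra.
Qed.

Lemma lebesgue_measure_half (A : set (measurableTypeR R)) : measurable A ->
  pushforward mu half A = mscale (2%:nng)%R mu A.
Proof.
move=> mA.
(* uniqueness of the measure with value b - a on ]a, b] *)
have E : mu A = pushforward (mscale ((2^-1)%:nng)%R mu) half A.
  apply: lebesgue_measure_unique => //= _ [[a b]] _ <-.
  rewrite /mscale/= /pushforward half_preimage_ocitv !lebesgue_measure_itv/=.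
  rewrite !lte_fin ltr_pM2l//; case: ifPn => _; last by rewrite mule0.
  by rewrite -!EFinB -EFinM; congr _%:E; field.
by rewrite [RHS]/mscale/= E /pushforward/= muleA -EFinM divff// mul1e.
Qed.

(** On a domain stable by halving, halving the variable costs at most the
    Jacobian 2, since the values are taken on a smaller domain. *)
Lemma integral_half (D : set R) (F : R -> \bar R) :
  is_interval D ->
  (forall t, D t -> D (t / 2)%R) ->
  (forall t, D t -> 0 <= F t) -> measurable_fun D F ->
  \int[mu]_(t in D) F (half t) <= 2%:E * \int[mu]_(t in D) F t.
Proof.
move=> iD Dh F0 mF; have mD : measurable D by exact: is_interval_measurable.
pose D' : set (measurableTypeR R) := [set s | D (2 * s)%R].
have iD' : is_interval D'.
  move=> s t Ds Dt u /andP[su ut]; apply: (iD _ _ Ds Dt).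
  by apply/andP; split; lra.
have mD' : measurable D' by exact: is_interval_measurable.
have D'D : D' `<=` D.
  by move=> s /Dh; rewrite mulrAC divff// mul1r.
have ED : D = half @^-1` D'.
  by apply/seteqP; split => t; rewrite /= /D' /half /= mulrA divff// mul1r.
rewrite {1}ED -(@ge0_integral_pushforward _ _ _ _ _ _ measurable_half mu D' F)//;
  last 2 first.
- exact: measurable_funS mF.
- by move=> t /set_mem /D'D; exact: F0.
rewrite (eq_measure_integral (mscale (2%:nng)%R mu)); last first.
  by move=> A mA _; exact: lebesgue_measure_half.
rewrite ge0_integral_mscale//; last 2 first.
- exact: measurable_funS mF.
- by move=> t /D'D; exact: F0.
rewrite lee_pmul2l// ?lte_fin//; exact: ge0_subset_integral.
Qed.
End real_line_integrals.

(** * Distribution functions and rearrangements *)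

Section rearrangements.
Context (R : realType) (gamma : \bar R).
Local Open Scope ereal_scope.
Local Notation L0 := {mfun_ (lebI gamma), (lebesgueTypeR R) >-> R}.
Implicit Types (f g h p q : L0) (l c : R).

Lemma measurable_level f l :
  measurable [set t : lebesgueTypeR R | itvI gamma t /\ (l < `|f t|)%R].
Proof.
apply: measurableI; first exact: measurable_itvI.
have mf : measurable_fun setT (fun t => `|(repr f) t|%R).
  exact: (measurableT_comp (@normr_measurable R setT) (measurable_funPT (repr f))).
have := mf measurableT _ (measurable_itv `]l, +oo[).
rewrite setTI => mA; apply: (eq_ind _ measurable mA).
by apply/seteqP; split => t /=; rewrite in_itv/= andbT.
Qed.

(** The form in which distribution functions are estimated below: the level
    set need only be covered up to a null subset of I. *)
Lemma distribution_le_measure h l (A : set (lebesgueTypeR R)) :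
  measurable A ->
  (\forall t \ae lebI gamma, itvI gamma t -> (l < `|h t|)%R -> A t) ->
  distribution_fun h l <= leb A.
Proof.
move=> mA [N [mN N0 hN]].
have mNI : measurable (N `&` itvI gamma).
  by apply: measurableI => //; exact: measurable_itvI.
apply: (@le_trans _ _ (leb (A `|` (N `&` itvI gamma)))).
  apply: le_measure; rewrite ?inE.
  - exact: measurable_level.
  - exact: measurableU.
  - move=> t [It lt]; have [At|nAt] := pselect (A t); [by left|right].
    by split => //; apply: hN => /= /(_ It lt).
apply: (le_trans (measureU2 _ mA mNI)).
have NI0 : leb (N `&` itvI gamma) = 0 by exact: N0.
by rewrite [X in _ + X]NI0 adde0.
Qed.

Lemma distribution_sub h p q l m :
  (\forall t \ae lebI gamma, `|h t| <= `|p t| + `|q t|)%R ->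
  distribution_fun h (l + m) <= distribution_fun p l + distribution_fun q m.
Proof.
move=> hpq; apply: le_trans (measureU2 _ (measurable_level p l) (measurable_level q m)).
apply: distribution_le_measure.
  by apply: measurableU; exact: measurable_level.
apply: filterS hpq => t hpq It lh.
have [lp|pl] := ltP l `|p t|%R; [by left|right; split => //].
rewrite -(ltrD2l l); apply: (lt_le_trans lh); apply: (le_trans hpq).
by rewrite lerD2r.
Qed.

Lemma distribution_scale_le h p c l :
  (\forall t \ae lebI gamma, `|h t| <= c * `|p t|)%R -> (0 < c)%R ->
  distribution_fun h (c * l) <= distribution_fun p l.
Proof.
move=> hp c0; apply: distribution_le_measure; first exact: measurable_level.
apply: filterS hp => t hp It lh; split => //.
by move: (lt_le_trans lh hp); rewrite ltr_pM2l.
Qed.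

Lemma rearrangement_ge0 f t : 0 <= rearrangement f t.
Proof.
by apply: le_ereal_inf_tmp => _ [l [l0 _] <-]; rewrite lee_fin ltW.
Qed.

Lemma rearrangement_le f t l : (0 < l)%R -> distribution_fun f l <= t%:E ->
  rearrangement f t <= l%:E.
Proof. by move=> l0 fl; apply: ereal_inf_lbound; exists l. Qed.

Lemma rearrangement_noninc f s t : (s <= t)%R ->
  rearrangement f t <= rearrangement f s.
Proof.
move=> st; apply: ereal_inf_le_tmp => _ [l [l0 fl] <-]; exists l => //.
by split => //; apply: (le_trans fl); rewrite lee_fin.
Qed.

(** If [|p| <= l] off a set of measure s and [|q| <= m] off a set of measure t,
    then [|p| + |q| <= l + m] off a set of measure s + t. *)
Lemma rearrangement_sub h p q s t :
  (\forall t \ae lebI gamma, `|h t| <= `|p t| + `|q t|)%R ->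
  rearrangement h (s + t) <= rearrangement p s + rearrangement q t.
Proof.
move=> hpq.
have [->|pf] := eqVneq (rearrangement p s) +oo.
  by rewrite addye ?leey// -ltNye (lt_le_trans _ (rearrangement_ge0 _ _))// ltNye.
have pfin : rearrangement p s \is a fin_num.
  by rewrite ge0_fin_numE ?rearrangement_ge0// ltey.
rewrite -leeBlDl//; apply: le_ereal_inf_tmp => _ [m [m0 qm] <-].
rewrite leeBlDl// -leeBlDr//; apply: le_ereal_inf_tmp => _ [l [l0 pl] <-].
rewrite leeBlDr// -EFinD; apply: rearrangement_le; first exact: addr_gt0.
by apply: (le_trans (distribution_sub l m hpq)); rewrite EFinD leeD.
Qed.

Lemma rearrangement_scale_le h p c t :
  (\forall t \ae lebI gamma, `|h t| <= c * `|p t|)%R -> (0 < c)%R ->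
  rearrangement h t <= c%:E * rearrangement p t.
Proof.
move=> hp c0; rewrite -lee_pdivrMl//.
apply: le_ereal_inf_tmp => _ [l [l0 pl] <-]; rewrite lee_pdivrMl// -EFinM.
apply: rearrangement_le; first exact: mulr_gt0.
exact: le_trans (distribution_scale_le _ hp c0) pl.
Qed.

End rearrangements.

(** * Modulars *)

Section ae_operations.
Context (R : realType) (gamma : \bar R).
Local Notation L0 := {mfun_ (lebI gamma), (lebesgueTypeR R) >-> R}.
Implicit Types (f g : L0).

Lemma ae_eqD f g : \forall t \ae lebI gamma, (f + g : L0) t = f t + g t.
Proof.
by apply: filterS (repr_aeEqMfun (lebI gamma) (repr f + repr g)) => t; apply.
Qed.

Lemma ae_eqZ (c : R) f : \forall t \ae lebI gamma, (c *: f : L0) t = c * f t.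
Proof.
by apply: filterS (repr_aeEqMfun (lebI gamma) (c *: repr f)) => t; apply.
Qed.

Lemma ae_eq_pi (F : {mfun lebesgueTypeR R >-> R}) :
  \forall t \ae lebI gamma, (\pi_L0 F : L0)%qT t = F t.
Proof.
by apply: filterS (repr_aeEqMfun (lebI gamma) F) => t; apply.
Qed.

End ae_operations.

Section modulars.
Context (R : realType) (gamma : \bar R) (w : R -> R) (w_weight : weight gamma w).
Local Open Scope ereal_scope.
Local Notation mu := (@lebesgue_measure R).
Local Notation L0 := {mfun_ (lebI gamma), (lebesgueTypeR R) >-> R}.
Local Notation D := [set t : R | (0 < t)%R /\ t%:E < gamma].
Implicit Types (f g h p q : L0).

Lemma interval_domain : is_interval D.
Proof.
move=> s t [s0 sg] [t0 tg] u /andP[su ut]; split; first exact: lt_le_trans su.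
by apply: le_lt_trans tg; rewrite lee_fin.
Qed.

Lemma measurable_domain : measurable D.
Proof. apply: is_interval_measurable; exact: interval_domain. Qed.

Lemma domain_lower s t : (0 < s)%R -> (s <= t)%R -> D t -> D s.
Proof. by move=> s0 st [_ tg]; split => //; apply: le_lt_trans tg; rewrite lee_fin. Qed.

Lemma weight_gt0 t : D t -> (0 < w t)%R.
Proof. by have [w0 _ _ _] := w_weight; move=> [t0 tg]; exact: w0. Qed.

Lemma weight_noninc s t : (0 < s)%R -> (s <= t)%R -> D t -> (w t <= w s)%R.
Proof. by have [_ wni _ _] := w_weight => s0 st [_ tg]; exact: wni. Qed.

Lemma measurable_weight : measurable_fun D (fun t => (w t)%:E).
Proof.
apply: nonincreasing_in_measurable => [|s t [s0 _] Dt st]; first exact: interval_domain.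
by rewrite lee_fin; exact: weight_noninc.
Qed.

#[local] Hint Resolve interval_domain measurable_domain : core.

Section one_function.
Variables (psi : R -> R) (psiP : orlicz psi).

Definition modular_integrand f (t : R) : \bar R :=
  er_map psi (rearrangement f t) * (w t)%:E.

Lemma modular_integrand_ge0 f t : D t -> 0 <= modular_integrand f t.
Proof.
move=> Dt; apply: mule_ge0; last by rewrite lee_fin ltW// weight_gt0.
by apply: (er_orlicz_ge0 psiP); exact: rearrangement_ge0.
Qed.

Lemma modular_integrand_noninc f s t : D s -> D t -> (s <= t)%R ->
  modular_integrand f t <= modular_integrand f s.
Proof.
move=> Ds Dt st; apply: lee_pmul.
- by apply: (er_orlicz_ge0 psiP); exact: rearrangement_ge0.
- by rewrite lee_fin ltW// weight_gt0.
- apply: (er_orlicz_le psiP); first exact: rearrangement_ge0.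
  exact: rearrangement_noninc.
- by rewrite lee_fin; apply: weight_noninc => //; case: Ds.
Qed.

Lemma measurable_modular_integrand f : measurable_fun D (modular_integrand f).
Proof.
by apply: nonincreasing_in_measurable => // s t; exact: modular_integrand_noninc.
Qed.

Lemma modular_ge0 f : 0 <= modular psi w f.
Proof. by apply: integral_ge0 => t; exact: modular_integrand_ge0. Qed.

Lemma modular_le_scale h p (c : R) : (0 < c <= 1)%R ->
  (\forall t \ae lebI gamma, `|h t| <= c * `|p t|)%R ->
  modular psi w h <= c%:E * modular psi w p.
Proof.
move=> c01 hp; have c0 : (0 < c)%R by case/andP: c01.
rewrite /modular -ge0_integralZl_EFin//; last 3 first.
- exact: modular_integrand_ge0.
- exact: measurable_modular_integrand.
- exact: ltW.
apply: ge0_le_integral => //.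
- exact: modular_integrand_ge0.
- exact: measurable_modular_integrand.
- by apply: measurable_funeM; exact: measurable_modular_integrand.
move=> t Dt; rewrite muleA; apply: lee_wpmul2r; first by rewrite lee_fin ltW// weight_gt0.
apply: (@le_trans _ _ (er_map psi (c%:E * rearrangement p t))).
  apply: (er_orlicz_le psiP); first exact: rearrangement_ge0.
  exact: rearrangement_scale_le.
by apply: (er_orlicz_contract psiP) => //; exact: rearrangement_ge0.
Qed.

Lemma modular_le h p : (\forall t \ae lebI gamma, `|h t| <= `|p t|)%R ->
  modular psi w h <= modular psi w p.
Proof.
move=> hp; rewrite -[leRHS]mul1e; apply: modular_le_scale; first by rewrite ltr01/=.
by apply: filterS hp => t; rewrite mul1r.
Qed.

(** A quasi-triangle inequality for the modular: [h] is bounded by the sum of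
    the halves of [p] and [q]. Its rearrangement at [t] is split at [t / 2] for
    both, [er_orliczD] separates them and restores the full [p] and [q], the
    decreasing weight only grows when [t] is replaced by [t / 2], and
    [integral_half] undoes the dilation. *)
Lemma modular_sub h p q :
  (\forall t \ae lebI gamma, 2 * `|h t| <= `|p t| + `|q t|)%R ->
  modular psi w h <= 2%:E * (modular psi w p + modular psi w q).
Proof.
move=> hpq.
rewrite /modular -ge0_integralD//; last 4 first.
- exact: modular_integrand_ge0.
- exact: measurable_modular_integrand.
- exact: modular_integrand_ge0.
- exact: measurable_modular_integrand.
have mpq : measurable_fun D (fun t => modular_integrand p t + modular_integrand q t).
  by apply: emeasurable_funD; exact: measurable_modular_integrand.
have Dh t : D t -> D (t / 2)%R.
  by move=> Dt; have t0 := Dt.1; apply: domain_lower Dt; lra.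
apply: le_trans (integral_half _ _ _ _) => //; last first.
- by move=> t Dt; apply: adde_ge0; exact: modular_integrand_ge0.
apply: ge0_le_integral => //.
- exact: modular_integrand_ge0.
- exact: measurable_modular_integrand.
- apply: nonincreasing_in_measurable => // s t Ds Dt st; rewrite /half.
  have Ds2 := Dh _ Ds; have Dt2 := Dh _ Dt; have st2 : (2^-1 * s <= 2^-1 * t)%R by lra.
  by apply: leeD; apply: modular_integrand_noninc => //; rewrite mulrC.
move=> t Dt; have := Dh _ Dt; rewrite mulrC -[(2^-1 * t)%R]/(half t) => Dt2.
rewrite /modular_integrand -ge0_muleDl; last 2 first.
- by apply: (er_orlicz_ge0 psiP); exact: rearrangement_ge0.
- by apply: (er_orlicz_ge0 psiP); exact: rearrangement_ge0.
apply: lee_pmul.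
- by apply: (er_orlicz_ge0 psiP); exact: rearrangement_ge0.
- by rewrite lee_fin ltW// weight_gt0.
- have halfE (u : \bar R) : 2%:E * ((2^-1)%:E * u) = u.
    by rewrite muleA -EFinM divff// mul1e.
  rewrite -[X in er_map _ X + _]halfE -[X in _ + er_map _ X]halfE.
  apply: le_trans (er_orliczD psiP _ _); rewrite ?mule_ge0 ?rearrangement_ge0//.
  apply: (er_orlicz_le psiP); first exact: rearrangement_ge0.
  have tE : (half t + half t)%R = t by rewrite /half; lra.
  rewrite -[X in rearrangement h X]tE.
  apply: (@le_trans _ _ (rearrangement ((2^-1)%R *: p) (half t)
                        + rearrangement ((2^-1)%R *: q) (half t))).
    apply: rearrangement_sub.
    apply: filterS3 hpq (ae_eqZ 2^-1 p) (ae_eqZ 2^-1 q) => s hs -> ->.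
    by rewrite !normrM normfV (ger0_norm (_ : 0 <= 2)%R)//; lra.
  have half_le u : rearrangement ((2^-1)%R *: u) (half t) <=
      (2^-1)%:E * rearrangement u (half t).
    apply: rearrangement_scale_le => //; apply: filterS (ae_eqZ 2^-1 u) => s ->.
    by rewrite normrM normfV (ger0_norm (_ : 0 <= 2)%R).
  by apply: leeD; exact: half_le.
- rewrite lee_fin; apply: weight_noninc => //; first by case: Dt2.
  by rewrite /half; case: Dt => t0 _; lra.
Qed.

End one_function.
End modulars.

(** * Bounded functions of bounded support *)

Section bounded_functions.
Context (R : realType) (gamma : \bar R) (w : R -> R) (w_weight : weight gamma w).
Local Open Scope ereal_scope.
Local Notation mu := (@lebesgue_measure R).
Local Notation L0 := {mfun_ (lebI gamma), (lebesgueTypeR R) >-> R}.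
Local Notation D := [set t : R | (0 < t)%R /\ t%:E < gamma].
Local Notation W x := (\int[mu]_(t in `]0%R, x[) (w t)%:E).
Implicit Types (f g h p q : L0).

Lemma leb_itv (a : R) : (0 <= a)%R ->
  leb (`[0%R, a[%classic : set (lebesgueTypeR R)) = a%:E.
Proof.
move=> a0; transitivity (@lebesgue_measure R `[0%R, a[%classic); first by [].
rewrite lebesgue_measure_itv/= lte_fin; case: ltP => [_|a0']; first by rewrite sube0.
by congr _%:E; apply/eqP; rewrite eq_le a0.
Qed.

Lemma itv_subset_domain a : D a -> `]0%R, a[ `<=` D.
Proof.
move=> Da t /=; rewrite in_itv/= => /andP[t0 ta].
exact: (domain_lower t0 (ltW ta) Da).
Qed.

Lemma weight_itv_ge0 a : D a -> 0 <= W a.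
Proof.
move=> Da; apply: integral_ge0 => t /(itv_subset_domain Da) Dt.
by rewrite lee_fin ltW// (weight_gt0 w_weight).
Qed.

Lemma weight_itv_fin a : D a -> W a \is a fin_num.
Proof.
move=> Da; rewrite ge0_fin_numE ?weight_itv_ge0//.
have [_ _ + _] := w_weight; apply.
by case: Da => a0 ag; split => //; exact: ltW.
Qed.

(** Absolute continuity of the integral of the weight. *)
Lemma weight_itv_small a (e : R) : D a -> (0 < e)%R ->
  exists d : R, [/\ (0 < d)%R, (d <= a)%R & W d <= e%:E].
Proof.
move=> Da e0; have a0 : (0 < a)%R by case: Da.
have mw : measurable_fun `]0%R, a[ (fun t => (w t)%:E).
  by apply: measurable_funS (measurable_weight w_weight);
    [exact: measurable_domain|exact: itv_subset_domain].
have intw : mu.-integrable setT (EFin \o (w \_ `]0%R, a[)).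
  rewrite -restrict_EFin; apply/(integrable_mkcond _ _).1 => //.
  apply/integrableP; split; first exact: mw.
  rewrite (eq_integral (fun t : measurableTypeR R => (w t)%:E)).
    by rewrite -ge0_fin_numE ?weight_itv_ge0 ?weight_itv_fin.
  move=> t /set_mem /(itv_subset_domain Da) Dt.
  by rewrite gee0_abs// lee_fin ltW// (weight_gt0 w_weight).
have [d [d0 dP]] := integral_normr_continuous intw e0.
exists (Num.min (d / 2) a)%R; rewrite lt_min a0 andbT divr_gt0//; split => //.
  by rewrite ge_min lexx orbT.
set b := Num.min _ _.
have ba : (b <= a)%R by rewrite /b ge_min lexx orbT.
have b0 : (0 < b)%R by rewrite /b lt_min a0 divr_gt0.
have Db : D b by exact: (domain_lower b0 ba Da).
have := dP `]0%R, b[%classic (measurable_itv _).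
rewrite [X in X < _](lebesgue_measure_itv `]0%R, b[)/= lte_fin b0 sube0 lte_fin => H.
have /H/ltW : (b < d)%R.
  by apply: (@le_lt_trans _ _ (d / 2)%R); [rewrite /b ge_min lexx|lra].
rewrite /Rintegral -lee_fin.
rewrite (eq_integral (fun t : measurableTypeR R => (w t)%:E)); last first.
  move=> t /set_mem tb; have := tb; rewrite /= in_itv/= => /andP[t0 tb'].
  rewrite patchE mem_set/=; last by rewrite in_itv/= t0 (lt_le_trans tb').
  have Dt := itv_subset_domain Db tb.
  by rewrite ger0_norm// ltW// (weight_gt0 w_weight).
by rewrite fineK// weight_itv_fin.
Qed.

Section one_function.
Variables (psi : R -> R) (psiP : orlicz psi).

(** The rearrangement of [h] is at most [c] everywhere, at most [l] beyond [d],
    and zero beyond [a]. With [d := a] this gives finite modulars; with [l] and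
    [d] small it makes the modular small when the distribution function is. *)
Lemma modular_le_bounded h (a c d l : R) : D a -> (0 < c)%R ->
  (0 < d)%R -> (d <= a)%R -> (0 < l)%R ->
  (\forall t \ae lebI gamma, `|h t| <= c)%R ->
  (\forall t \ae lebI gamma,
     ~ (`[0%R, a[%classic : set (lebesgueTypeR R)) t -> h t = 0%R) ->
  distribution_fun h l <= d%:E ->
  modular psi w h <= (psi c)%:E * W d + (psi l)%:E * W a.
Proof.
move=> Da c0 d0 da l0 hc ha hl; have a0 : (0 < a)%R by case: Da.
have Dd : D d by exact: (domain_lower d0 da Da).
(* h* <= c, since |h| > c only on a null set *)
have hc' t : (0 <= t)%R -> rearrangement h t <= c%:E.
  move=> t0; apply: rearrangement_le => //; apply: (@le_trans _ _ 0); last by rewrite lee_fin.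
  rewrite -[leRHS](measure0 (@leb R)); apply: distribution_le_measure => //.
  by apply: filterS hc => s hs _; rewrite ltNge hs.
(* h* vanishes beyond a, since h is supported in [0, a[ *)
have ha' t : (a <= t)%R -> rearrangement h t = 0.
  move=> at_; apply/eqP; rewrite eq_le rearrangement_ge0 andbT.
  apply/lee_addgt0Pr => e e0; rewrite add0e; apply: rearrangement_le => //.
  apply: (@le_trans _ _ a%:E); last by rewrite lee_fin.
  rewrite -leb_itv; last exact: ltW.
  apply: distribution_le_measure; first by apply: sub_caratheodory; exact: measurable_itv.
  apply: filterS ha => s hs [s0 _] es; apply: contrapT => /hs hs0.
  by move: es; rewrite hs0 normr0 ltNge (ltW e0).
have psi0 : psi 0%R = 0%R by case: psiP.
pose G (k b : R) (t : R) : \bar R := (fun t => (psi k)%:E * (w t)%:E) \_ `]0%R, b[ t.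
have mG k b : D b -> measurable_fun D (G k b).
  move=> Db.
  apply: (proj1 (@measurable_restrict _ _ (measurableTypeR R) _ `]0%R, b[ D _ _ _)) => //.
    exact: measurable_domain.
  apply: measurable_funeM; apply: measurable_funS (measurable_weight w_weight) => //.
  exact: measurable_domain.
have G0 k b t : (0 <= k)%R -> D t -> 0 <= G k b t.
  move=> k0 Dt; rewrite /G patchE; case: ifP => _ //.
  by apply: mule_ge0; rewrite lee_fin;
    [exact: orlicz_ge0|exact/ltW/(weight_gt0 w_weight)].
have intG k b : (0 <= k)%R -> D b -> \int[mu]_(t in D) G k b t = (psi k)%:E * W b.
  move=> k0 Db; rewrite -integral_mkcondr.
  have -> : D `&` `]0%R, b[ = `]0%R, b[%classic.
    by apply/setIidPr; exact: itv_subset_domain.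
  rewrite ge0_integralZl_EFin ?orlicz_ge0//.
  - by move=> t /(itv_subset_domain Db) Dt; rewrite lee_fin ltW// (weight_gt0 w_weight).
  - apply: measurable_funS (measurable_weight w_weight).
      exact: measurable_domain.
    exact: itv_subset_domain.
rewrite -(intG c d (ltW c0) Dd) -(intG l a (ltW l0) Da).
rewrite -ge0_integralD//; last 5 first.
- exact: measurable_domain.
- by move=> t; apply: G0; exact: ltW.
- exact: mG.
- by move=> t; apply: G0; exact: ltW.
- exact: mG.
rewrite /modular; apply: ge0_le_integral.
- exact: measurable_domain.
- by move=> t; exact: (modular_integrand_ge0 w_weight psiP).
- exact: (measurable_modular_integrand w_weight psiP).
- by apply: emeasurable_funD; exact: mG.
move=> t Dt; have t0 : (0 < t)%R by case: Dt.
have w0 : 0 <= (w t)%:E by rewrite lee_fin ltW// (weight_gt0 w_weight).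
have [ta|at_] := ltP t a; last first.
  rewrite ha'//= psi0 mul0e; apply: adde_ge0; apply: G0 => //; exact: ltW.
have [td|dt] := ltP t d.
  apply: (@le_trans _ _ (G c d t)); last by rewrite leeDl// G0// ltW.
  rewrite /G patchE mem_set/= ?in_itv/= ?t0//.
  apply: lee_wpmul2r => //.
  exact: (er_orlicz_le psiP (rearrangement_ge0 _ _) (hc' _ (ltW t0))).
apply: (@le_trans _ _ (G l a t)); last by rewrite leeDr// G0// ltW.
rewrite /G patchE mem_set/= ?in_itv/= ?t0//.
apply: lee_wpmul2r => //; rewrite -[(psi l)%:E]/(er_map psi l%:E).
apply: (er_orlicz_le psiP); first exact: rearrangement_ge0.
by apply: (@rearrangement_le _ _ _ _ l) => //; apply: (le_trans hl); rewrite lee_fin.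
Qed.

End one_function.
End bounded_functions.

(** * The Orlicz-Lorentz space and its order-continuous part *)

Section spaces.
Context (R : realType) (gamma : \bar R) (w : R -> R) (w_weight : weight gamma w).
Local Open Scope ereal_scope.
Local Notation L0 := {mfun_ (lebI gamma), (lebesgueTypeR R) >-> R}.
Local Notation D := [set t : R | (0 < t)%R /\ t%:E < gamma].
Local Notation W x := (\int[@lebesgue_measure R]_(t in `]0%R, x[) (w t)%:E).
Implicit Types (f g h p q : L0) (c : R).

(** Continuity from above of Lebesgue measure along the decreasing level sets. *)
Lemma distribution_cvg0 (f_ : nat -> L0) (l : R) : (0 < l)%R ->
  distribution_fun (f_ 0%N) l < +oo ->
  (\forall t \ae lebI gamma, nonincreasing_seq (fun n => `|f_ n t|%R) /\
     (fun n => `|f_ n t|%R) @ \oo --> (0 : R)%R) ->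
  forall e : R, (0 < e)%R ->
    \forall n \near \oo, distribution_fun (f_ n) l <= e%:E.
Proof.
move=> l0 f0 [N [mN N0 fN]] e e0.
pose E n := [set t : lebesgueTypeR R | itvI gamma t /\ (l < `|f_ n t|)%R] `\` N.
have mE n : measurable (E n) by apply: measurableD => //; exact: measurable_level.
have good t : ~ N t -> nonincreasing_seq (fun n => `|f_ n t|%R) /\
     (fun n => `|f_ n t|%R) @ \oo --> (0 : R)%R.
  by move=> nN; apply: contrapT => nf; exact/nN/fN.
have EI : \bigcap_n E n = set0.
  apply/seteqP; split => // t Et; have [_ nN] := Et 0%N I.
  have [_ ft0] := good t nN.
  have /cvgrPdist_lt/(_ l l0)[n _ /(_ n (leqnn n))] := ft0.
  have [[_ lt] _] := Et n I.
  by rewrite sub0r normrN normr_id ltNge (ltW lt).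
have : @leb R \o E @ \oo --> @leb R (\bigcap_n E n).
  apply: nonincreasing_cvg_mu => //.
  - apply: le_lt_trans f0; apply: le_measure; rewrite ?inE//.
      exact: measurable_level.
    by move=> t [].
  - by rewrite EI.
  - move=> m n mn; apply/subsetPset => t [[It lt] nN]; split => //; split => //.
    have [fni _] := good t nN; exact: lt_le_trans lt (fni _ _ mn).
rewrite EI measure0 => cE.
have : \forall n \near \oo, leb (E n) < e%:E.
  apply: (cE [set x | x < e%:E]); apply: open_nbhs_nbhs; split.
    exact: open_ereal_lt_ereal.
  by rewrite /= lte_fin.
apply: filterS => n /ltW; apply: le_trans.
apply: distribution_le_measure => //.
exists N; split => // t /= nt; apply: contrapT => nN; apply: nt => It lt.
by split.
Qed.

Let carrier (a : R) : set (lebesgueTypeR R) := `[0%R, a[%classic.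

Let measurable_carrier a : measurable (carrier a).
Proof. by apply: sub_caratheodory; exact: measurable_itv. Qed.

Definition indic_itv (a : R) : L0 :=
  (\pi_L0 (indic_mfun (carrier a) (measurable_carrier a)))%qT.

Lemma indic_itvE a : \forall t \ae lebI gamma, indic_itv a t = (t \in carrier a)%:R%R.
Proof.
apply: filterS (ae_eq_pi gamma (indic_mfun _ (measurable_carrier a))) => t ->.
by rewrite /= mindicE.
Qed.

Lemma indic_itv_neq0 a : D a -> indic_itv a != 0%R.
Proof.
move=> [a0 ag]; apply/eqP => chi0.
have : \forall t \ae lebI gamma, ~ carrier a t.
  apply: filterS3 (indic_itvE a) (ae_eqZ 0 (indic_itv a)) (ae_eqZ 0 (indic_itv a)) => t.
  rewrite scale0r -chi0 => -> + _; rewrite mul0r => + ta.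
  by rewrite mem_set// => /eqP; rewrite oner_eq0.
move=> [N [mN N0 aN]].
have : leb (carrier a) <= lebI gamma N.
  apply: le_measure; rewrite ?inE.
  - exact: measurable_carrier.
  - by apply: measurableI => //; exact: measurable_itvI.
  move=> t ta; split; first by apply: aN => /=; apply.
  move: ta; rewrite /carrier/= in_itv/= => /andP[t0 ta]; split => //.
  by apply: lt_trans ag; rewrite lte_fin.
by rewrite N0 leb_itv ?(ltW a0)// lee_fin leNgt a0.
Qed.

Section modular_space.
Variables (psi : R -> R) (psiP : orlicz psi).

Lemma modular_fin_contract f c : (0 < c)%R -> modular psi w f < +oo ->
  exists s : R, (0 < s <= 1)%R /\ s%:E * modular psi w f <= c%:E.
Proof.
move=> c0 ffin; pose m := fine (modular psi w f).
have mE : modular psi w f = m%:E.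
  by rewrite fineK// ge0_fin_numE// (modular_ge0 w_weight psiP).
have m0 : (0 <= m)%R by rewrite -lee_fin -mE (modular_ge0 w_weight psiP).
have d0 : (0 < m + c + 1)%R by rewrite addr_gt0// ltr_wpDl.
exists (c / (m + c + 1))%R; rewrite divr_gt0//= ler_pdivrMr// mE -EFinM lee_fin.
split; first lra.
by rewrite mulrAC ler_pdivrMr// ler_wpM2l//; lra.
Qed.

Lemma Lambda_contract f c : Lambda psi w f -> (0 < c)%R ->
  exists2 k : R, (0 < k)%R & modular psi w (k *: f) <= c%:E.
Proof.
move=> [k k0 fk] c0; have [s [s01 sc]] := modular_fin_contract c0 fk.
have s0 : (0 < s)%R by case/andP: s01.
exists (s * k)%R; first exact: mulr_gt0.
apply: le_trans sc; apply: (modular_le_scale w_weight psiP s01).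
apply: filterS2 (ae_eqZ (s * k)%R f) (ae_eqZ k f) => t -> ->.
by rewrite -mulrA normrM gtr0_norm.
Qed.

Lemma luxemburg_le f (e : R) : (0 < e)%R -> modular psi w (e^-1 *: f)%R <= 1 ->
  luxemburg psi w f <= e%:E.
Proof. by move=> e0 fe; apply: ereal_inf_lbound; exists e. Qed.

Lemma luxemburg_ge0 f : 0 <= luxemburg psi w f.
Proof.
by apply: le_ereal_inf_tmp => _ [e [e0 _] <-]; rewrite lee_fin ltW.
Qed.

Lemma modular_scale_mono f (a b : R) : (0 <= a)%R -> (a <= b)%R ->
  modular psi w (a *: f)%R <= modular psi w (b *: f)%R.
Proof.
move=> a0 ab; apply: (modular_le w_weight psiP).
apply: filterS2 (ae_eqZ a f) (ae_eqZ b f) => t -> ->.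
by rewrite !normrM ler_wpM2r// !ger0_norm// (le_trans a0).
Qed.

Lemma luxemburg_lt f (e : R) : luxemburg psi w f < e%:E ->
  modular psi w (e^-1 *: f)%R <= 1.
Proof.
move=> /ereal_inf_lt[_ [d [d0 fd] <-]]; rewrite lte_fin => de.
apply: le_trans fd; apply: modular_scale_mono.
  by rewrite invr_ge0 (le_trans (ltW d0))// ltW.
by rewrite lef_pV2// ?posrE ?(lt_trans d0)// ltW.
Qed.

Lemma le_luxemburg h p : (\forall t \ae lebI gamma, `|h t| <= `|p t|)%R ->
  luxemburg psi w h <= luxemburg psi w p.
Proof.
move=> hp; apply: le_ereal_inf_tmp => _ [e [e0 pe] <-].
apply: luxemburg_le e0 _; apply: le_trans pe; apply: (modular_le w_weight psiP).
apply: filterS3 hp (ae_eqZ e^-1 h) (ae_eqZ e^-1 p) => t ht -> ->.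
by rewrite !normrM ler_wpM2l.
Qed.

(** By convexity a small multiple of an element of the space has modular at
    most 1. *)
Lemma luxemburg_small f (e : R) : Lambda psi w f -> (0 < e)%R ->
  exists2 r : R, (0 < r)%R & luxemburg psi w (r *: f)%R < e%:E.
Proof.
move=> Lf e0; have [k k0 fk] := Lambda_contract Lf ltr01.
exists (e / 2 * k)%R; first by rewrite mulr_gt0// divr_gt0.
apply: (@le_lt_trans _ _ (e / 2)%:E); last by rewrite lte_fin; lra.
apply: luxemburg_le; first by rewrite divr_gt0.
by rewrite scalerA mulKf// gt_eqF// divr_gt0.
Qed.

(** Translates norm convergence into the terms in which the estimates above are
    stated. *)
Lemma luxemburg_cvg0 (f_ : nat -> L0) :
  luxemburg psi w \o f_ @ \oo --> (0 : \bar R) <->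
  forall e : R, (0 < e)%R ->
    \forall n \near \oo, modular psi w (e^-1 *: f_ n)%R <= 1.
Proof.
split => [f0 e e0|fe].
  have : \forall n \near \oo, luxemburg psi w (f_ n) < e%:E.
    by apply: (f0 [set x | x < e%:E]); apply: open_nbhs_nbhs; split;
      [exact: open_ereal_lt_ereal|rewrite /= lte_fin].
  by apply: filterS => n; exact: luxemburg_lt.
apply/fine_cvgP; split.
  by apply: filterS (fe 1%R ltr01) => n /(luxemburg_le ltr01) fn;
    rewrite ge0_fin_numE ?luxemburg_ge0// (le_lt_trans fn)// ltry.
apply/cvgrPdist_le => e e0; apply: filterS (fe e e0) => n /(luxemburg_le e0) fn.
rewrite sub0r normrN ger0_norm ?fine_ge0 ?luxemburg_ge0//.
by rewrite -lee_fin fineK// ge0_fin_numE ?luxemburg_ge0// (le_lt_trans fn)// ltry.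
Qed.

Section indicator.
Variables (a : R) (Da : D a).

Let le_indic_itv f : (\forall t \ae lebI gamma, `|f t| <= `|indic_itv a t|)%R ->
  (\forall t \ae lebI gamma, `|f t| <= 1)%R /\
  (\forall t \ae lebI gamma, ~ carrier a t -> f t = 0%R).
Proof.
move=> fa; split; apply: filterS2 fa (indic_itvE a) => t ft ct;
  move: ft; rewrite ct.
  by move=> /le_trans; apply; rewrite normr_nat; case: (_ \in _).
by move=> + nt; rewrite memNset// normr0 normr_le0 => /eqP.
Qed.

Let distribution_carrier f l : (0 < l)%R ->
  (\forall t \ae lebI gamma, ~ carrier a t -> f t = 0%R) ->
  distribution_fun f l <= a%:E.
Proof.
move=> l0 fa; rewrite -leb_itv; last by apply: ltW; case: Da.
apply: distribution_le_measure; first exact: measurable_carrier.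
apply: filterS fa => t ft It lt; apply: contrapT => /ft ft0.
by move: lt; rewrite ft0 normr0 ltNge (ltW l0).
Qed.

Lemma Lambda_indic_itv : Lambda psi w (indic_itv a).
Proof.
have a0 : (0 < a)%R by case: Da.
exists 1%R; rewrite ?ltr01// scale1r.
have [chi1 chi0] := le_indic_itv (filterE _ (fun t => lexx `|indic_itv a t|%R)).
apply: (@le_lt_trans _ _ ((psi 1)%:E * W a + (psi 1)%:E * W a)).
  apply: (modular_le_bounded w_weight psiP Da ltr01 a0 (lexx _) ltr01 chi1 chi0).
  exact: distribution_carrier ltr01 chi0.
have fin : ((psi 1)%:E * W a) \is a fin_num.
  by rewrite fin_numM// (weight_itv_fin w_weight).
by rewrite lte_add_pinfty// ltey_eq fin.
Qed.

(** Dominated convergence for the modular, read off [modular_le_bounded]: the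
    level [l] makes the second term small, then the length [d] makes the first
    one small, and the distribution functions at the corresponding level
    eventually fall below [d]. *)
Lemma dominated_modular_cvg0 (f_ : nat -> L0) :
  (forall n, \forall t \ae lebI gamma, `|f_ n t| <= `|indic_itv a t|)%R ->
  (\forall t \ae lebI gamma, nonincreasing_seq (fun n => `|f_ n t|%R) /\
     (fun n => `|f_ n t|%R) @ \oo --> (0 : R)%R) ->
  forall e : R, (0 < e)%R ->
    \forall n \near \oo, modular psi w (e^-1 *: f_ n)%R <= 1.
Proof.
move=> f_le f0 e e0; have ei0 : (0 < e^-1)%R by rewrite invr_gt0.
have psi1 := orlicz_ge0 psiP ler01; have psie := orlicz_ge0 psiP (ltW ei0).
have WaE : W a = (fine (W a))%:E by rewrite fineK// (weight_itv_fin w_weight).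
have Wa0 : (0 <= fine (W a))%R by rewrite fine_ge0// (weight_itv_ge0 w_weight).
(* psi l <= l * psi 1 by convexity, so that psi l * W a <= 1/2 *)
pose b : R := (2 * (psi 1 * fine (W a) + 1))%R.
have b0 : (0 < b)%R by rewrite mulr_gt0// ltr_wpDl// mulr_ge0.
have half1 : (2^-1 + 2^-1 = 1 :> R)%R by lra.
have b2 : (2 <= b)%R by rewrite /b ler_peMr// lerDr mulr_ge0.
pose l : R := (b^-1)%R.
have l0 : (0 < l)%R by rewrite invr_gt0.
have l1 : (0 <= l <= 1)%R by rewrite (ltW l0) invf_le1//; lra.
have psie2 : (psi e^-1 <= 2^-1 * (2 * (psi e^-1 + 1)))%R by lra.
have psil2 : (psi 1 * fine (W a) <= 2^-1 * b)%R by rewrite /b; lra.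
have [|d [d0 da Wd]] := @weight_itv_small _ _ _ w_weight a (2 * (psi e^-1 + 1))^-1 Da.
  by rewrite invr_gt0 mulr_gt0// ltr_wpDl.
have el0 : (0 < e * l)%R by exact: mulr_gt0.
have f0fin : distribution_fun (f_ 0%N) (e * l) < +oo.
  apply: (@le_lt_trans _ _ a%:E); last exact: ltry.
  by apply: distribution_carrier => //; have [] := le_indic_itv (f_le 0%N).
apply: filterS (distribution_cvg0 el0 f0fin f0 d0) => n fnd.
have [fn1 fna] := le_indic_itv (f_le n).
apply: le_trans (modular_le_bounded w_weight psiP Da ei0 d0 da l0 _ _ _) _.
- apply: filterS2 fn1 (ae_eqZ e^-1 (f_ n)) => t fn1 ->.
  by rewrite normrM gtr0_norm// ler_piMr// ltW.
- apply: filterS2 fna (ae_eqZ e^-1 (f_ n)) => t fna -> /fna ->.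
  by rewrite mulr0.
- apply: le_trans fnd; rewrite -[X in distribution_fun _ X <= _](mulKf (lt0r_neq0 e0)).
  apply: distribution_scale_le => //.
  by apply: filterS (ae_eqZ e^-1 (f_ n)) => t ->; rewrite normrM gtr0_norm.
- rewrite -half1 EFinD.
  apply: leeD.
    apply: (@le_trans _ _ ((psi e^-1)%:E * ((2 * (psi e^-1 + 1))^-1)%:E)).
      exact: lee_wpmul2l.
    by rewrite -EFinM lee_fin ler_pdivrMr ?mulr_gt0// ltr_wpDl.
  rewrite WaE -EFinM lee_fin.
  apply: (@le_trans _ _ (l * psi 1 * fine (W a))%R).
    by apply: ler_wpM2r => //; have := orlicz_contract psiP l1 ler01; rewrite mulr1.
  by rewrite -mulrA mulrC ler_pdivrMr.
Qed.

Lemma Lambda_a_indic_itv : Lambda_a psi w (indic_itv a).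
Proof.
split; first exact: Lambda_indic_itv.
move=> f_ f_le f0; split.
  apply/nonincreasing_seqP => n; apply: le_luxemburg.
  by apply: filterS f0 => t [/nonincreasing_seqP].
exact/luxemburg_cvg0/dominated_modular_cvg0.
Qed.

End indicator.

Lemma ae_double_scaleD f g (k k1 k2 : R) : (0 <= k)%R ->
  (2 * k <= k1)%R -> (2 * k <= k2)%R ->
  \forall t \ae lebI gamma,
    (2 * `|(k *: (f + g) : L0) t| <= `|(k1 *: f : L0) t| + `|(k2 *: g : L0) t|)%R.
Proof.
move=> k0 k1k k2k.
apply: filterS3 (ae_eqZ k (f + g)%R) (ae_eqD f g) (filterI (ae_eqZ k1 f) (ae_eqZ k2 g)).
move=> t -> -> [-> ->]; rewrite !normrM (ger0_norm k0) mulrA.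
apply: le_trans (_ : (2 * k * (`|f t| + `|g t|) <= _)%R).
  by apply: ler_wpM2l; [lra|exact: ler_normD].
rewrite mulrDr; apply: lerD; apply: ler_wpM2r => //.
  by apply: (le_trans k1k); exact: ler_norm.
by apply: (le_trans k2k); exact: ler_norm.
Qed.

(** Zero is reached as a multiple of the indicator of [[0, a[]. *)
Lemma Lambda_subspace a : D a ->
  vect_subspace (Lambda (gamma := gamma) psi w).
Proof.
move=> Da.
have LD : forall f g, Lambda psi w f -> Lambda psi w g -> Lambda psi w (f + g)%R.
  move=> f g [k1 k10 fk] [k2 k20 gk]; exists (Num.min k1 k2 / 2)%R.
    by rewrite divr_gt0// lt_min k10.
  apply: (@le_lt_trans _ _ (2%:E *
      (modular psi w (k1 *: f)%R + modular psi w (k2 *: g)%R))).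
    apply: (modular_sub w_weight psiP); apply: ae_double_scaleD.
    - by rewrite divr_ge0// le_min !ltW.
    - by rewrite mulrC divfK// ge_min lexx.
    - by rewrite mulrC divfK// ge_min lexx orbT.
  by apply: (lte_mul_pinfty _ _ (lte_add_pinfty fk gk)).
have LZ : forall (c : R) f, Lambda psi w f -> Lambda psi w (c *: f)%R.
  move=> c f [k k0 fk]; exists (k / (`|c| + 1))%R.
    by rewrite divr_gt0// ltr_wpDl.
  apply: le_lt_trans fk; apply: (modular_le w_weight psiP).
  apply: filterS3 (ae_eqZ (k / (`|c| + 1))%R (c *: f)%R) (ae_eqZ c f) (ae_eqZ k f).
  move=> t -> -> ->; rewrite mulrA !normrM ler_wpM2r//.
  rewrite normfV -mulrA ler_piMr// (ger0_norm (_ : 0 <= `|c| + 1)%R) ?addr_ge0//.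
  by rewrite mulrC ler_pdivrMr ?mul1r ?lerDl// ltr_wpDl.
split => //; rewrite -(scale0r (indic_itv a)); apply: LZ; exact: Lambda_indic_itv Da.
Qed.

Let abs_mfun f : {mfun lebesgueTypeR R >-> R} := max_mfun (repr f) (- repr f)%R.

Let abs_mfunE f t : abs_mfun f t = `|f t|%R.
Proof. exact: maxrN. Qed.

(** For a sum, a sequence below [|f + g|] decreasing to zero is the sum of one
    below [|f|] and one below [|g|], and [modular_sub] recombines them. *)
Lemma Lambda_a_subspace a : D a ->
  vect_subspace (Lambda_a (gamma := gamma) psi w).
Proof.
move=> Da; have [L0_ LD LZ] := Lambda_subspace Da.
have two_ge0 : 0 <= 2%:E :> \bar R by rewrite lee_fin.
have two_quarters : (2 * (4^-1 + 4^-1) = 1 :> R)%R by lra.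
have quarter_eight : (2 <= 4^-1 * 8 :> R)%R by lra.
have AD : forall f g, Lambda_a psi w f -> Lambda_a psi w g -> Lambda_a psi w (f + g)%R.
  move=> f g [Lf ocf] [Lg ocg]; split; first exact: LD.
  move=> h_ hfg h0.
  (* Riesz decomposition of |h_n| into a part below |f| and a part below |g|,
     both of which still decrease to zero *)
  pose p_ n : L0 := (\pi_L0 (min_mfun (abs_mfun (h_ n)) (abs_mfun f)))%qT.
  pose q_ n : L0 :=
    (\pi_L0 (max_mfun (abs_mfun (h_ n) - abs_mfun f)%R
                       (0%R : {mfun lebesgueTypeR R >-> R})))%qT.
  have pE : \forall t \ae lebI gamma, forall n, p_ n t = Num.min `|h_ n t|%R `|f t|%R.
    apply: ae_foralln => n.
    apply: filterS (ae_eq_pi gamma (min_mfun (abs_mfun (h_ n)) (abs_mfun f))) => t ->.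
    by rewrite -!abs_mfunE.
  have qE : \forall t \ae lebI gamma, forall n, q_ n t = Num.max (`|h_ n t| - `|f t|)%R 0%R.
    apply: ae_foralln => n.
    apply: filterS (ae_eq_pi gamma (max_mfun (abs_mfun (h_ n) - abs_mfun f)%R 0%R)) => t ->.
    by rewrite -!abs_mfunE.
  have p0 : \forall t \ae lebI gamma, nonincreasing_seq (fun n => `|p_ n t|%R) /\
      (fun n => `|p_ n t|%R) @ \oo --> (0 : R)%R.
    apply: filterS2 pE h0 => t pE [hni ht0].
    have pE' n : `|p_ n t|%R = Num.min `|h_ n t|%R `|f t|%R.
      by rewrite pE ger0_norm// le_min !normr_ge0.
    split.
      by move=> m n mn; rewrite !pE' le_min2// hni.
    apply: (squeeze_cvgr _ (cvg_cst 0%R) ht0).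
    by apply: nearW => n; rewrite normr_ge0 pE' ge_min lexx.
  have q0 : \forall t \ae lebI gamma, nonincreasing_seq (fun n => `|q_ n t|%R) /\
      (fun n => `|q_ n t|%R) @ \oo --> (0 : R)%R.
    apply: filterS2 qE h0 => t qE [hni ht0].
    have qE' n : `|q_ n t|%R = Num.max (`|h_ n t| - `|f t|)%R 0%R.
      by rewrite qE ger0_norm// le_max lexx orbT.
    split.
      by move=> m n mn; rewrite !qE' le_max2// lerB// hni.
    apply: (squeeze_cvgr _ (cvg_cst 0%R) ht0).
    by apply: nearW => n; rewrite normr_ge0 qE' ge_max normr_ge0 gerBl normr_ge0.
  have pf n : \forall t \ae lebI gamma, (`|p_ n t| <= `|f t|)%R.
    apply: filterS pE => t ->.
    by rewrite ger0_norm ?ge_min ?lexx ?orbT// le_min !normr_ge0.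
  have qg n : \forall t \ae lebI gamma, (`|q_ n t| <= `|g t|)%R.
    apply: filterS3 qE (hfg n) (ae_eqD f g) => t -> ht fgt; rewrite fgt in ht.
    rewrite ger0_norm; last by rewrite le_max lexx orbT.
    rewrite ge_max normr_ge0 andbT lerBlDl; apply: (le_trans ht); exact: ler_normD.
  have [_ /luxemburg_cvg0 Np] := ocf _ pf p0.
  have [_ /luxemburg_cvg0 Nq] := ocg _ qg q0.
  split.
    apply/nonincreasing_seqP => n; apply: le_luxemburg.
    by apply: filterS h0 => t [/nonincreasing_seqP].
  apply/luxemburg_cvg0 => e e0.
  (* by convexity, passing from 8 / e to 2 / e turns the bound 1 into 1/4,
     and 2 * (1/4 + 1/4) = 1 closes modular_sub *)
  have e8 : (0 < e / 8)%R by rewrite divr_gt0.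
  apply: filterS2 (Np _ e8) (Nq _ e8) => n pn qn.
  apply: (@le_trans _ _ (2%:E *
      (modular psi w (2 / e *: p_ n)%R + modular psi w (2 / e *: q_ n)%R))).
    apply: (modular_sub w_weight psiP).
    apply: filterS3 (filterI pE qE) (ae_eqZ e^-1 (h_ n))
      (filterI (ae_eqZ (2 / e) (p_ n)) (ae_eqZ (2 / e) (q_ n))).
    move=> t [pt qt] -> [-> ->]; rewrite pt qt !normrM.
    rewrite (ger0_norm (_ : 0 <= Num.min _ _)%R) ?le_min ?normr_ge0//.
    rewrite (ger0_norm (_ : 0 <= Num.max _ _)%R) ?le_max ?lexx ?orbT//.
    rewrite -mulrDr normfV (gtr0_norm e0) (gtr0_norm (_ : 0 < 2)%R)// mulrA.
    apply: ler_wpM2l; first by rewrite divr_ge0// ltW.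
    have [hf|fh] := leP `|h_ n t|%R `|f t|%R; first by rewrite lerDl le_max lexx orbT.
    by rewrite -lerBlDl le_max lexx.
  have quarter f' : modular psi w ((e / 8)^-1 *: f')%R <= 1 ->
      modular psi w (2 / e *: f')%R <= (4^-1)%:E.
    move=> f1; apply: (@le_trans _ _ ((4^-1)%:E * modular psi w ((e / 8)^-1 *: f')%R)).
      apply: (modular_le_scale w_weight psiP).
        by rewrite invr_gt0 ltr0n/= invf_le1// ler1n.
      apply: filterS2 (ae_eqZ (2 / e) f') (ae_eqZ (e / 8)^-1 f') => t -> ->.
      rewrite (normrM (2 / e)%R) (normrM (e / 8)^-1%R) mulrA; apply: ler_wpM2r => //.
      rewrite invf_div !gtr0_norm ?divr_gt0//.
      by rewrite mulrA; apply: ler_wpM2r; rewrite ?invr_ge0 ?(ltW e0).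
    by rewrite -[leRHS]mule1 lee_wpmul2l// lee_fin.
  apply: (@le_trans _ _ (2%:E * ((4^-1)%:E + (4^-1)%:E))).
    exact: (lee_wpmul2l two_ge0 (leeD (quarter _ pn) (quarter _ qn))).
  by rewrite -EFinD -EFinM two_quarters.
have AZ : forall (c : R) f, Lambda_a psi w f -> Lambda_a psi w (c *: f)%R.
  move=> c f [Lf ocf]; split; first exact: LZ.
  move=> h_ hcf h0; have c0 : (0 < `|c| + 1)%R by rewrite ltr_wpDl.
  pose d : R := (`|c| + 1)%R.
  have dE : \forall t \ae lebI gamma, forall n,
      `|(d^-1 *: h_ n : L0) t|%R = (d^-1 * `|h_ n t|)%R.
    apply: ae_foralln => n; apply: filterS (ae_eqZ d^-1 (h_ n)) => t ->.
    by rewrite normrM gtr0_norm// invr_gt0.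
  have [||_ /luxemburg_cvg0 Nd] := ocf (fun n => d^-1 *: h_ n)%R.
  - move=> n; apply: filterS3 dE (hcf n) (ae_eqZ c f) => t -> ht ct.
    rewrite ler_pdivrMl//; apply: (le_trans ht); rewrite ct normrM.
    by rewrite ler_wpM2r// lerDl.
  - apply: filterS2 dE h0 => t dt [hni ht0]; split.
      by move=> m n mn; rewrite !dt ler_wpM2l ?invr_ge0 ?(ltW c0)// hni.
    under eq_fun do rewrite dt.
    by rewrite -(mulr0 d^-1%R); apply: cvgMr.
  split.
    apply/nonincreasing_seqP => n; apply: le_luxemburg.
    by apply: filterS h0 => t [/nonincreasing_seqP].
  apply/luxemburg_cvg0 => e e0.
  have ed : (0 < e / d)%R by exact: divr_gt0.
  apply: filterS (Nd _ ed) => n; rewrite scalerA invf_div.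
  by rewrite mulrAC divff ?mul1r// gt_eqF.
split => //; rewrite -(scale0r (indic_itv a)); apply: AZ; exact: Lambda_a_indic_itv Da.
Qed.

End modular_space.
End spaces.

(** * Spaceability *)

Lemma exists_domain (R : realType) (gamma : \bar R) : (0 < gamma)%E ->
  exists a : R, 0 < a /\ (a%:E < gamma)%E.
Proof.
case: gamma => [r| |]//; last by exists 1; split; [exact: ltr01|exact: ltry].
rewrite lte_fin => r0; exists (r / 2); split; first exact: divr_gt0.
by rewrite lte_fin; lra.
Qed.

Theorem corollary4p3 (R : realType) (alpha : Type) (gamma : \bar R)
    (w phi : R -> R) (phi_ : nat -> R -> R)
    (alpha_infinite : [set: nat] #<= [set: alpha])
    (gamma_gt0 : (0 < gamma)%E)
    (w_weight : weight gamma w)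
    (phi_orlicz : orlicz phi)
    (phin_orlicz : forall n, orlicz (phi_ n))
    (phin_Delta : forall n, Delta_oo phi (phi_ n))
    (phin_prec : gamma = +oo%E -> forall n, prec (phi_ n.+1) (phi_ n))
    (phin_prec_oo : (gamma < +oo)%E ->
       forall n, prec_oo (phi_ n.+1) (phi_ n)) :
  ([set: alpha] #<= [set: R] \/
     card_lt (Lambda_a (gamma := gamma) phi w) [set: alpha] ->
   forall beta : Type, [set: alpha] #<= [set: beta] ->
   ~ spaceable (luxemburg phi w) (Lambda_a (gamma := gamma) phi w)
       (Lambda_a phi w `\` \bigcup_n Lambda (phi_ n) w) alpha beta)
  /\
  ((gamma = +oo%E -> Delta2 phi) -> ((gamma < +oo)%E -> Delta2_oo phi) ->
   forall beta : Type, [set: alpha] #<= [set: beta] ->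
   ~ spaceable (luxemburg phi w) (Lambda (gamma := gamma) phi w)
       (Lambda phi w `\` \bigcup_n Lambda (phi_ n) w) alpha beta).
Proof.
have [a Da] := exists_domain gamma_gt0.
have sU n := Lambda_subspace w_weight (phin_orlicz n) Da.
have Ug n := Lambda_indic_itv w_weight (phin_orlicz n) Da.
have g0 := indic_itv_neq0 Da.
split.
- move=> _ beta _; apply: (complement_not_spaceable
    (Lambda_a_subspace w_weight phi_orlicz Da) sU
    (Lambda_a_indic_itv w_weight phi_orlicz Da) Ug g0 alpha_infinite).
  by move=> u e [Lu _]; exact: luxemburg_small.
- move=> _ _ beta _; apply: (complement_not_spaceable
    (Lambda_subspace w_weight phi_orlicz Da) sU
    (Lambda_indic_itv w_weight phi_orlicz Da) Ug g0 alpha_infinite).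
  by move=> u e; exact: luxemburg_small.
Qed.
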